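(* For every $N\ge3$, $\operatorname{spec}(B_N)\subset\mathcal X_{\pi/4}$.
   Context: Indices of $\mathbb C^N$ are in $\mathbb Z/N\mathbb Z$ with standard basis $(e_j)$; $S e_j=e_{j+1}$ is the periodic shift. The Scottish flag matrix is $$B_N=S-S^{-1}+2\operatorname{diag}\bigl(\sin(2\pi j/N)\bigr)_{j\in\mathbb Z/N\mathbb Z}.$$ $\mathcal X_{\pi/4}:=e^{i\pi/4}\mathbb R\cup e^{3i\pi/4}\mathbb R\subset\mathbb C$. *)

(* Defs.v *)
From mathcomp Require Import all_boot all_order all_algebra complex.
From mathcomp Require Import classical_sets reals trigo.

Set Implicit Arguments.
Unset Strict Implicit.
Unset Printing Implicit Defensive.

Import Order.TTheory GRing.Theory Num.Theory.

Local Open Scope classical_set_scope.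
Local Open Scope complex_scope.
Local Open Scope ring_scope.

(* The field of complex numbers is R[i] for an arbitrary R : realType.        *)
(* Matrices act on column vectors, e_j = delta_mx j 0, and Z/NZ is 'I_N with  *)
(* its cyclic successor ordS, so that shift_mx R N *m e_j = e_(j + 1).        *)
Definition shift_mx (R : realType) (N : nat) : 'M[R[i]]_N :=
  \matrix_(i, j) (i == ordS j)%:R.

Definition scottish_flag (R : realType) (N : nat) : 'M[R[i]]_N :=
  shift_mx R N - invmx (shift_mx R N)
  + 2 *: diag_mx (\row_(j < N) (sin (2 * pi * j%:R / N%:R))%:C).

(* eigenvalue is phrased with row vectors; over a field, a square matrix and  *)
(* its transpose have the same eigenvalues.                                   *)
Definition spec (R : realType) (N : nat) (A : 'M[R[i]]_N) : set R[i] :=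
  [set z | eigenvalue A z].

Definition expi (R : realType) (t : R) : R[i] := cos t +i* sin t.

Definition line (R : realType) (w : R[i]) : set R[i] :=
  [set w * x%:C | x in [set: R]].

Definition X_pi4 (R : realType) : set R[i] :=
  line (expi (pi / 4)) `|` line (expi (3 * pi / 4)).
Arguments X_pi4 R _ : clear implicits.

(* Main.v *)
Require Import Defs.
From mathcomp Require Import all_boot all_order all_algebra complex.
From mathcomp Require Import classical_sets reals trigo.
From mathcomp Require Import perm ring lra zify.

(* Put h = exp(i pi / N) and w = h^2. A Gaussian times the discrete Fourier
   matrix conjugates B_N to a weighted N-cycle with zero diagonal, whose two
   weights on the edge (k, k + 1) have product i (x + 1/x), x = h w^k. Up to
   the factor i these products are real, so B_N is, up to exp(i pi / 4),
   Hermitian for an indefinite diagonal form g. If the underlying graph is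
   bipartite and g is positive on one of its two sides, the squares of the
   eigenvalues are purely imaginary.

   If 4 | N such a g exists on the N-cycle. If not, det B_N = 0, since the
   Fourier matrix conjugates B_N to -i B_N. Replacing h by another z <> 0 in
   x = z w^k changes the characteristic polynomial by a constant only (Chambers'
   argument: as a Laurent polynomial in z of degree at most N, it is invariant
   under z -> w z, and its z^N and z^-N coefficients do not involve the
   spectral variable). For z = i w one edge can be removed, again at the cost
   of a constant. What remains is a path with edge products
   -2 i sin(2 pi (k + 1) / N), whose determinant vanishes too, so the constants
   cancel; on the path a form g as above exists. *)

Set Implicit Arguments.
Unset Strict Implicit.
Unset Printing Implicit Defensive.

Import Order.TTheory GRing.Theory Num.Theory.
Local Open Scope complex_scope.
Local Open Scope ring_scope.

Ltac decide_nat_rel := repeat match goal with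
  | |- context [@eq_op ?T ?a ?b] => first
    [ have -> : @eq_op T a b = false by lia | have -> : @eq_op T a b = true by lia ]
  | |- context [leq ?a ?b] => first
    [ have -> : leq a b = false by lia | have -> : leq a b = true by lia ] end.

(** * Determinants of weighted paths and cycles *)

Section TridiagonalMatrices.
Variable F : fieldType.
Implicit Types (a b : nat -> F) (d : F).

(** Here [e i j] stands for an edge from [j] to [i]. Both weights carry the index of the source:
    [a j] is the entry at (i, j), [b j] the one at (j, i). *)
Definition edge_mx n (e : rel 'I_n) a b : 'M[F]_n :=
  \matrix_(i, j) ((e i j)%:R * a j + (e j i)%:R * b i).

Definition path_mx n a b := edge_mx (fun i j : 'I_n => i == j.+1 :> nat) a b.

Definition cycle_mx n a b := edge_mx (fun i j : 'I_n => i == ordS j) a b.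

(** The continuant recurrence, by expansion along the last row and then along the last column of the
    remaining minor. *)
Lemma det_path_mx_rec n d a b :
  \det (d%:M - path_mx n.+2 a b) =
  d * \det (d%:M - path_mx n.+1 a b) - a n * b n * \det (d%:M - path_mx n a b).
Proof.
rewrite (expand_det_row _ ord_max) !big_ord_recr /= big1 ?add0r; last first.
  move=> i _; rewrite !mxE /= -!val_eqE /=; have := ltn_ord i => hi.
  decide_nat_rel.
  by rewrite !mul0r !addr0 oppr0 addr0 mul0r.
rewrite addrC; congr (_ + _).
  rewrite !mxE eqxx /= !mulr1n; decide_nat_rel.
  rewrite !mul0r addr0 subr0; congr (_ * _).
  rewrite /cofactor /= -signr_odd oddD addbb mul1r; congr (\det _).
  apply/matrixP => i j; rewrite !mxE -!val_eqE /= /bump.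
  by have hi := ltn_ord i; have hj := ltn_ord j; decide_nat_rel.
rewrite !mxE -!val_eqE /= eqxx; decide_nat_rel.
rewrite mulr0n mul0r addr0 mul1r sub0r !mulNr; congr (- _).
rewrite -mulrA; congr (_ * _).
rewrite /cofactor /= -signr_odd addSn oddS oddD addbb /= expr1 mulN1r.
rewrite (expand_det_col _ ord_max) big_ord_recr /= big1 ?add0r; last first.
  move=> i _; rewrite !mxE -!val_eqE /= /bump; have := ltn_ord i => hi.
  decide_nat_rel.
  rewrite !add0n; decide_nat_rel.
  by rewrite !mul0r !addr0 oppr0 addr0 mul0r.
rewrite !mxE -!val_eqE /= /bump ltnn leqnn !add0n add1n.
decide_nat_rel.
rewrite mulr0n mul0r !add0r mul1r mulNr opprK; congr (_ * _).
rewrite /cofactor /= -signr_odd oddD addbb mul1r; congr (\det _).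
apply/matrixP => i j; rewrite !mxE -!val_eqE /= /bump.
have := ltn_ord i; have := ltn_ord j => hj hi.
by decide_nat_rel.
Qed.

(** The recurrence sees the weights only through the edge products. *)
Lemma det_path_mx_prod n d a b a' b' :
    (forall k, (k.+1 < n)%N -> a k * b k = a' k * b' k) ->
  \det (d%:M - path_mx n a b) = \det (d%:M - path_mx n a' b').
Proof.
elim/ltn_ind: n => -[|[|n]] IHn hab.
- by rewrite !det_mx00.
- by rewrite !det_mx11 !mxE /= !mul0r.
rewrite !det_path_mx_rec hab // IHn // => [|k hk]; last by apply: hab; lia.
by rewrite [in LHS](IHn n) // => k hk; apply: hab; lia.
Qed.

(** At [d = 0] the recurrence loses its first term, so two more vertices only multiply the
    determinant by minus an edge product. *)
Lemma det_path_mx0_add2 n k a b :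
  \det (- path_mx n a b) = 0 -> \det (- path_mx (n + k.*2) a b) = 0.
Proof.
move=> h0; elim: k => [|k IHk]; first by rewrite addn0.
have := det_path_mx_rec (n + k.*2) 0 a b; rewrite !raddf0 !add0r mul0r IHk mulr0.
by rewrite subr0 doubleS !addnS.
Qed.

Lemma det_add_scale_delta_mx n (A : 'M[F]_n) c i j :
  \det (A + c *: delta_mx i j) = \det A + c * cofactor A i j.
Proof.
rewrite !(expand_det_row _ i) -[in RHS](mulr1 c).
have cofE k : cofactor (A + c *: delta_mx i j) i k = cofactor A i k.
  rewrite /cofactor; congr (_ * \det _); apply/matrixP => r s.
  by rewrite !mxE eq_sym (negPf (neq_lift _ _)) mulr0 addr0.
under eq_bigr do rewrite cofE !mxE eqxx mulrDl.
rewrite big_split /=; congr (_ + _); rewrite (bigD1 j) //= eqxx big1 ?addr0 //.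
by move=> k kj; rewrite (negPf kj) mulr0 mul0r.
Qed.

(** The closing edge leaves one entry, in the last row and first column. Its minor is triangular
    with diagonal entries [- b i], so its contribution is free of [d]. *)
Lemma det_cycle_mx_cut n d a b : (2 < n)%N -> a n.-1 = 0 ->
  \det (d%:M - cycle_mx n a b) = \det (d%:M - path_mx n a b)
    - b n.-1 * ((-1) ^+ n.-1 * \prod_(i < n.-1) - b i).
Proof.
case: n => [|[|n]] //= n0 a0.
have ordSE (i : 'I_n.+2) :
    val (ordS i) = (if i == n.+1 :> nat then 0 else i.+1)%N :> nat.
  rewrite /=; case: eqP => [->|hi]; first by rewrite modnn.
  by rewrite modn_small //; have := ltn_ord i; lia.
have -> : d%:M - cycle_mx n.+2 a b =
    d%:M - path_mx n.+2 a b + (- b n.+1) *: delta_mx ord_max 0.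
  rewrite -addrA; congr (_ + _); apply/matrixP => i j.
  rewrite !mxE -!val_eqE !ordSE /=; have hi := ltn_ord i; have hj := ltn_ord j.
  case: (eqVneq (i : nat) n.+1) => [->|hi'].
    have -> : (j == n.+2 :> nat) = false by lia.
    case: (eqVneq (j : nat) n.+1) => [->|hj'].
      by rewrite !a0 !mulr0; have -> : (n.+1 == 0) = false; [lia|ring].
    by case: (j == 0 :> nat); rewrite /=; ring.
  case: (eqVneq (j : nat) n.+1) => [->|hj'].
    by rewrite !a0 !mulr0 /=; ring.
  by rewrite /= mulr0 addr0.
rewrite det_add_scale_delta_mx mulNr; congr (_ - _ * _).
rewrite /cofactor /= addn0; congr (_ * _); rewrite det_trig.
  apply: eq_bigr => i _; rewrite !mxE -!val_eqE /= /bump leq0n add1n.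
  have hi := ltn_ord i; decide_nat_rel.
  by rewrite mulr0n mul0r mul1r !add0r.
apply/is_trig_mxP => i j ij; rewrite !mxE -!val_eqE /= /bump leq0n add1n.
have hi := ltn_ord i; decide_nat_rel.
by rewrite mulr0n !mul0r !addr0 subr0.
Qed.
End TridiagonalMatrices.

(** * Determinants of quadratic matrix polynomials *)

Lemma size_index_ord n : size (index_enum 'I_n) = n.
Proof. by rewrite -[RHS](size_enum_ord n) enumT /index_enum; unlock. Qed.

Section QuadraticFamilies.
Variable F : fieldType.

Lemma size_coef_prod_le (I : Type) (r : seq I) m (f : I -> {poly F}) :
    (forall i, (size (f i) <= m.+1)%N) ->
  (size (\prod_(i <- r) f i)%R <= (size r * m).+1)%N /\
  (\prod_(i <- r) f i)`_(size r * m) = \prod_(i <- r) (f i)`_m.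
Proof.
move=> hf; elim: r => [|i r [IHs IHc]].
  by rewrite !big_nil size_poly1 coef1.
rewrite !big_cons /= mulSn; have hfi := hf i; split.
  apply: leq_trans (size_polyMleq _ _) _.
  by move: hfi IHs; set u := size (f i); set v := size (\prod_(k <- r) f k)%R; lia.
rewrite -IHc coefM (bigD1 (inord m)) //= inordK; last by lia.
rewrite addKn [X in _ + X]big1 ?addr0 // => j; rewrite -val_eqE /= inordK; last by lia.
move=> jm; have [jlt|jgt] := ltnP j m.
  by rewrite [X in _ * X]nth_default ?mulr0 //; apply: leq_trans IHs _; lia.
by rewrite nth_default ?mul0r //; apply: leq_trans hfi _; lia.
Qed.

Variable n : nat.
Implicit Types A : 'M[F]_n.

Definition quad_mx A0 A1 A2 : 'M[{poly F}]_n :=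
  \matrix_(i, j) ((A0 i j)%:P + A1 i j *: 'X + A2 i j *: 'X^2).

Lemma horner_det_quad_mx A0 A1 A2 x :
  (\det (quad_mx A0 A1 A2)).[x] = \det (A0 + x *: A1 + x ^+ 2 *: A2).
Proof.
rewrite -[LHS]/(horner_eval x _) -det_map_mx; congr (\det _).
by apply/matrixP => i j; rewrite !mxE /= /horner_eval !hornerE /=; ring.
Qed.

Lemma size_quad_mx A0 A1 A2 i j : (size (quad_mx A0 A1 A2 i j) <= 3)%N.
Proof.
rewrite mxE; apply: leq_trans (size_polyD _ _) _; rewrite geq_max; apply/andP; split.
  apply: leq_trans (size_polyD _ _) _; rewrite geq_max; apply/andP; split.
    by exact: leq_trans (size_polyC_leq1 _) _.
  by apply: leq_trans (size_scale_leq _ _) _; rewrite size_polyX.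
by apply: leq_trans (size_scale_leq _ _) _; rewrite size_polyXn.
Qed.

Lemma size_det_quad_mx A0 A1 A2 : (size (\det (quad_mx A0 A1 A2)) <= (n * 2).+1)%N.
Proof.
apply: leq_trans (size_sum _ _ _) _; apply/bigmax_leqP => s _.
rewrite size_Msign.
have [h _] := size_coef_prod_le (index_enum 'I_n)
  (fun i => size_quad_mx A0 A1 A2 i (s i)).
by apply: leq_trans h _; rewrite size_index_ord.
Qed.

Lemma coef0_det_quad_mx A0 A1 A2 : (\det (quad_mx A0 A1 A2))`_0 = \det A0.
Proof.
by rewrite -horner_coef0 horner_det_quad_mx scale0r expr0n scale0r !addr0.
Qed.

Lemma coef_top_det_quad_mx A0 A1 A2 :
  (\det (quad_mx A0 A1 A2))`_(n * 2) = \det A2.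
Proof.
rewrite coef_sum; apply: eq_bigr => s _.
have coefMsign (c : bool) (q : {poly F}) k : ((-1) ^+ c * q)`_k = (-1) ^+ c * q`_k.
  by rewrite !mulr_sign; case: c; rewrite ?coefN.
rewrite coefMsign; congr (_ * _).
have [_] := size_coef_prod_le (index_enum 'I_n)
  (fun i => size_quad_mx A0 A1 A2 i (s i)).
rewrite size_index_ord => ->; apply: eq_bigr => i _.
by rewrite mxE !coefD coefC !coefZ coefX coefXn /= !mulr0 !add0r mulr1.
Qed.

(* [det (A0 + x A1 + x^2 A2)] is invariant under [x -> w x], so only the powers
   [x^0], [x^n] and [x^(2n)] survive in it. *)
Lemma det_quad_mx_rot A0 A1 A2 w : n.-primitive_root w ->
    (forall i j, A0 i j = w * A0 (ordS i) (ordS j)) ->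
    (forall i j, A1 i j = A1 (ordS i) (ordS j)) ->
    (forall i j, w * A2 i j = A2 (ordS i) (ordS j)) ->
  exists c, forall x, \det (A0 + x *: A1 + x ^+ 2 *: A2) =
    \det A0 + c * x ^+ n + \det A2 * x ^+ (n * 2).
Proof.
move=> w_prim hA0 hA1 hA2; set p := \det (quad_mx A0 A1 A2).
have n_gt0 := prim_order_gt0 w_prim.
pose s := perm (@ordS_inj n).
(* Substituting [w X] for [X] amounts to shifting rows and columns cyclically and multiplying by
   [w]. The determinant is unchanged because [w ^+ n = 1] and the sign of the shift occurs twice. *)
have p_comp : p \Po (w *: 'X) = p.
  rewrite -[LHS]/(comp_poly _ _) -det_map_mx.
  have -> : map_mx (comp_poly (w *: 'X)) (quad_mx A0 A1 A2) =
            w%:P *: row_perm s (col_perm s (quad_mx A0 A1 A2)).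
    apply/matrixP => i j; rewrite !mxE /= !permE -hA1 -hA2 (hA0 i j).
    rewrite !comp_polyD comp_polyC !comp_polyZ comp_polyX comp_Xn_poly exprZn.
    by rewrite -!mul_polyC !rmorphM /=; ring.
  rewrite detZ -polyC_exp (prim_expr_order w_prim) mul1r row_permE col_permE.
  by rewrite !det_mulmx !det_perm odd_permV mulrCA -expr2 sqrr_sign mulr1.
have p_coef k : p`_k != 0 -> (n %| k)%N.
  move=> pk; have /(congr1 (fun q : {poly F} => q`_k)) := p_comp.
  rewrite comp_polyE; under eq_bigr do rewrite exprZn scalerA.
  rewrite -(poly_def _ (fun i => p`_i * w ^+ i)) coef_poly.
  case: ltnP => [_|hk]; last by move/esym/eqP; rewrite (negPf pk).
  move/eqP; rewrite -subr_eq0 -{2}[p`_k]mulr1 -mulrBr mulf_eq0 (negPf pk) /=.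
  by rewrite subr_eq0 -(prim_order_dvd w_prim).
exists p`_n => x; rewrite -horner_det_quad_mx -/p.
rewrite (horner_coef_wide x (size_det_quad_mx _ _ _)) -/p.
rewrite (bigD1 ord0) // coef0_det_quad_mx expr0 mulr1 -addrA; congr (_ + _).
have hn : (n < (n * 2).+1)%N by lia.
rewrite (bigD1 (Ordinal hn)) /=; last by rewrite -val_eqE /= -lt0n.
congr (_ + _); rewrite (bigD1 ord_max) /=; last first.
  by rewrite -!val_eqE /=; lia.
rewrite coef_top_det_quad_mx big1 ?addr0 // => i; rewrite -!val_eqE /= => hi.
have [->|/p_coef /dvdnP[k hk]] := eqVneq p`_i 0; first by rewrite mul0r.
have hlt := ltn_ord i; rewrite hk in hlt hi.
by have : (k < 3)%N; [nia|case: k hk hi hlt => [|[|[|]]] //=; nia].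
Qed.

End QuadraticFamilies.

(** * Chambers' argument for the weighted cycle *)

Section FlagCycle.
Variables (F : fieldType) (n : nat) (w c : F).
Hypothesis w_prim : n.-primitive_root w.

(** If c^2 = -1, the edge product at k is c (x + 1/x) with x = z w^k. *)
Definition flag_cycle z : 'M[F]_n :=
  cycle_mx n (fun k => z * w ^+ k - c) (fun k => c - (z * w ^+ k)^-1).

Lemma prim_exprS (j : 'I_n) : w ^+ ordS j = w * w ^+ j.
Proof. by rewrite /= (prim_expr_mod w_prim) exprS. Qed.

(** Multiplied by u, the matrix [d%:M - flag_cycle u] becomes quadratic in u, and [d] occurs only in
    its middle coefficient [A1]. Hence [d] affects only the term [m], which does not depend on u. *)
Lemma det_flag_cycle_transfer (z z' d : F) : z != 0 -> z' != 0 ->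
    \det (d%:M - flag_cycle z) = \det (- flag_cycle z) ->
  \det (d%:M - flag_cycle z') = \det (- flag_cycle z').
Proof.
have n_gt0 := prim_order_gt0 w_prim.
have w_neq0 : w != 0 by rewrite (prim_root_eq0 w_prim) -lt0n.
pose A0 : 'M[F]_n := \matrix_(i, j) ((j == ordS i)%:R * (w ^+ i)^-1).
pose A1 e : 'M[F]_n := e%:M +
  \matrix_(i, j) ((i == ordS j)%:R * c - (j == ordS i)%:R * c).
pose A2 : 'M[F]_n := \matrix_(i, j) (- (i == ordS j)%:R * w ^+ j).
have hdet e : exists m, forall u : F, u != 0 -> \det (e%:M - flag_cycle u) =
    (u ^+ n)^-1 * \det A0 + m + u ^+ n * \det A2.
  have [||| m hm] := @det_quad_mx_rot F n A0 (A1 e) A2 w w_prim.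
  - move=> i j; rewrite !mxE (inj_eq (@ordS_inj n)) prim_exprS invfM.
    by rewrite mulrCA [w * _]mulrA divff // mul1r.
  - by move=> i j; rewrite !mxE !(inj_eq (@ordS_inj n)).
  - by move=> i j; rewrite !mxE !(inj_eq (@ordS_inj n)) prim_exprS; ring.
  exists m => u u_neq0; have un_neq0 : u ^+ n != 0 by rewrite expf_neq0.
  apply: (mulfI un_neq0); rewrite -detZ.
  have -> : u *: (e%:M - flag_cycle u) = A0 + u *: A1 e + u ^+ 2 *: A2.
    apply/matrixP => i j; rewrite !mxE.
    have wi_neq0 : w ^+ i != 0 by rewrite expf_neq0.
    by rewrite -mulr_natr; field; rewrite u_neq0 wi_neq0.
  by rewrite hm exprM; field.
have [m hm] := hdet d; have [m0 hm0] := hdet 0.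
have e0 u : \det (- flag_cycle u) = \det (0%:M - flag_cycle u).
  by rewrite raddf0 sub0r.
move=> z0 z0'; rewrite !e0 (hm z z0) (hm z' z0') (hm0 z z0) (hm0 z' z0').
by move=> /addIr/addrI ->.
Qed.

End FlagCycle.

(** * Matrices that are Hermitian up to a factor for an indefinite form *)

Section Indefinite.
Variables (C : numClosedFieldType) (n : nat) (K : 'M[C]_n).
Variables (g : 'I_n -> C) (P : pred 'I_n).
Hypothesis g_real : forall i, g i \is Num.real.
Hypothesis g_gt0 : forall i, P i -> 0 < g i.
Hypothesis K_bip : forall i j, P i = P j -> K i j = 0.
Hypothesis K_herm : forall i j, K i j * g j = 'i * (g i * K j i)^*.

(** For a left eigenvector, let E and O be its g-norms on the two sides. Pairing the eigenvalue
    equation with each side gives d O = i conj(d) E, so i d^2 O = - |d|^2 E with E and O real; it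
    remains to see that O is nonzero. *)
Lemma bipartite_eigenvalue_real d :
  \det (d%:M - K) = 0 -> 'i * d ^+ 2 \is Num.real.
Proof.
move/eqP/det0P => [v v_neq0 hv].
have {}hv j : d * v 0 j = \sum_i v 0 i * K i j.
  have /rowP/(_ j) := hv; rewrite mulmxBr mul_mx_scalar !mxE => /eqP.
  by rewrite subr_eq0 => /eqP.
pose E := \sum_(j | P j) g j * (v 0 j * (v 0 j)^*).
pose O := \sum_(j | ~~ P j) g j * (v 0 j * (v 0 j)^*).
have vv_real j : g j * (v 0 j * (v 0 j)^*) \is Num.real.
  by rewrite realM // ger0_real // mul_conjC_ge0.
have E_real : E \is Num.real by apply: sum_real.
have O_real : O \is Num.real by apply: sum_real.
pose X := \sum_(j | P j) \sum_(i | ~~ P i) v 0 i * (v 0 j)^* * (K i j * g j).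
have hE : d * E = X.
  rewrite mulr_sumr; apply: eq_bigr => j Pj.
  rewrite [LHS](_ : _ = g j * (v 0 j)^* * (d * v 0 j)); last by ring.
  rewrite hv mulr_sumr (bigID P) /= big1 ?add0r; last first.
    by move=> i Pi; rewrite K_bip ?Pi ?Pj // !mulr0.
  by apply: eq_bigr => i _; ring.
have hO : d * O = 'i * X^*.
  rewrite mulr_sumr rmorph_sum mulr_sumr; under [RHS]eq_bigr do
    rewrite rmorph_sum mulr_sumr.
  rewrite exchange_big /=; apply: eq_bigr => i nPi.
  rewrite [LHS](_ : _ = g i * (v 0 i)^* * (d * v 0 i)); last by ring.
  rewrite hv mulr_sumr (bigID P) /= addrC big1 ?add0r.
    apply: eq_bigr => j Pj; rewrite !rmorphM /= conjCK.
    rewrite [LHS](_ : _ = v 0 j * (v 0 i)^* * (K j i * g i)); last by ring.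
    by rewrite K_herm !rmorphM /=; ring.
  by move=> j nPj; rewrite K_bip ?mulr0 // (negPf nPi) (negPf nPj).
have [->|d_neq0] := eqVneq d 0; first by rewrite expr0n mulr0 real0.
(* Positivity of [g] on [P] makes v vanish there if E = 0; the eigenvalue equation then makes it
   vanish on the other side too. *)
have E_neq0 : E != 0.
  apply: contraNneq v_neq0 => E0.
  have vP j : P j -> v 0 j = 0.
    move=> Pj; have := E0 => /eqP; rewrite psumr_eq0; last first.
      by move=> i Pi; rewrite mulr_ge0 ?mul_conjC_ge0 // ltW ?g_gt0.
    move=> /allP /(_ j (mem_index_enum _)) /implyP /(_ Pj).
    by rewrite mulf_eq0 gt_eqF ?g_gt0 //= mul_conjC_eq0 => /eqP.
  apply/eqP/rowP => j; rewrite mxE; have [Pj|nPj] := boolP (P j); first exact: vP.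
  apply: (mulfI d_neq0); rewrite hv mulr0 big1 // => i _.
  have [Pi|nPi] := boolP (P i); first by rewrite vP // mul0r.
  by rewrite K_bip ?mulr0 // (negPf nPi) (negPf nPj).
have hOE : d * O = 'i * d^* * E.
  by rewrite hO -hE rmorphM /= (CrealP E_real) mulrA.
have O_neq0 : O != 0.
  apply: contraNneq E_neq0 => O0; move/eqP: hOE; rewrite O0 mulr0 eq_sym.
  by rewrite !mulf_eq0 (negPf (neq0Ci _)) conjC_eq0 (negPf d_neq0).
have e : 'i * d ^+ 2 = - (d * d^* ) * E / O.
  apply: (mulIf O_neq0); rewrite mulfVK // expr2 -!mulrA hOE.
  rewrite [LHS](_ : _ = 'i ^+ 2 * (d * (d^* * E))); last by ring.
  by rewrite sqrCi; ring.
rewrite [X in X \is _]e.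
by rewrite realM ?realV // realM // realN ger0_real // mul_conjC_ge0.
Qed.

End Indefinite.

Lemma edge_mx_eigenvalue_real (C : numClosedFieldType) n (e : rel 'I_n)
    (a b : nat -> C) (g : 'I_n -> C) (P : pred 'I_n) d :
    (forall i, g i \is Num.real) -> (forall i, P i -> 0 < g i) ->
    (forall i j, e i j -> P i = ~~ P j) ->
    (forall i j, e i j -> b j * g i = 'i * (g j * a j)^*) ->
  \det (d%:M - edge_mx e a b) = 0 -> 'i * d ^+ 2 \is Num.real.
Proof.
move=> g_real g_gt0 eP hbg; apply: (bipartite_eigenvalue_real g_real g_gt0).
  move=> i j Pij; rewrite mxE.
  have -> : e i j = false by apply/negP => /eP; rewrite Pij; case: (P j).
  have -> : e j i = false by apply/negP => /eP; rewrite Pij; case: (P j).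
  by rewrite !mul0r addr0.
(* The map sending x to i conj(x) is an involution, so the relation on an edge yields the one on the
   reversed edge. *)
have hag i j : e i j -> a j * g j = 'i * (g i * b j)^*.
  move=> /hbg /(congr1 (fun x : C => 'i * x^* )).
  rewrite [g i * _]mulrC => ->; rewrite rmorphM /= conjCK conjCi.
  by rewrite [RHS](_ : _ = - 'i ^+ 2 * (a j * g j)); [rewrite sqrCi; ring|ring].
move=> i j; rewrite !mxE mulrDl mulrDr rmorphD mulrDr.
rewrite addrC /=; congr (_ + _).
  case eji: (e j i); last by rewrite !mul0r mulr0 rmorph0 mulr0.
  by rewrite !mul1r (hbg _ _ eji).
case eij: (e i j); last by rewrite !mul0r mulr0 rmorph0 mulr0.
by rewrite !mul1r (hag _ _ eij).
Qed.

(** * The unit circle and the two diagonal lines *)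

Section Expi.
Variable R : realType.
Implicit Types s t : R.

Lemma expiD s t : expi (s + t) = expi s * expi t.
Proof. by apply/eqP; rewrite eq_complex /= cosD sinD addrC !eqxx /= addrC. Qed.

Lemma expi0 : expi 0 = 1 :> R[i].
Proof. by rewrite /expi cos0 sin0. Qed.

Lemma expiX t n : expi t ^+ n = expi (n%:R * t).
Proof.
elim: n => [|n IHn]; first by rewrite mul0r expi0.
by rewrite exprS IHn -expiD -[in RHS]natr1 mulrDl mul1r addrC.
Qed.

Lemma expi_mulN t : expi t * expi (- t) = 1.
Proof. by rewrite -expiD subrr expi0. Qed.

Lemma expi_neq0 t : expi t != 0.
Proof.
by apply: contra_eq_neq (expi_mulN t) => ->; rewrite mul0r eq_sym oner_eq0.
Qed.

Lemma expiN t : expi (- t) = (expi t)^-1.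
Proof. by apply: (mulfI (expi_neq0 t)); rewrite expi_mulN divff ?expi_neq0. Qed.

Lemma expi_pi : expi pi = -1 :> R[i].
Proof. by apply/eqP; rewrite eq_complex /= cospi sinpi oppr0 !eqxx. Qed.

Lemma expi_subV t : expi t - (expi t)^-1 = 2 * 'i * (sin t)%:C.
Proof.
rewrite -expiN; apply/eqP; rewrite eq_complex /= cosN sinN.
by apply/andP; split; apply/eqP; ring.
Qed.

(** The imaginary part of i z^2 is x^2 - y^2; its two linear factors cut out the two lines. *)
Lemma i_real_X_pi4 (z : R[i]) : 'i * z ^+ 2 \is Num.real -> X_pi4 R z.
Proof.
case: z => x y.
have -> : 'i * (x +i* y) ^+ 2 = (- (x * y + y * x)) +i* (x * x - y * y) :> R[i].
  by apply/eqP; rewrite eq_complex /=; apply/andP; split; apply/eqP; ring.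
rewrite complex_real -expr2 -[y * y]expr2 subr_sqr mulf_eq0.
have cE : sin (pi / 4) = cos (pi / 4) :> R.
  by rewrite -cosBpihalf -cosN; congr cos; field.
have c_neq0 : cos (pi / 4) != 0 :> R.
  have pi_gt0 := pi_gt0 R.
  by rewrite gt_eqF // cos_gt0_pihalf //; apply/andP; split; lra.
have e3 : 3 * pi / 4 = pi / 4 + pi / 2 :> R by field.
case/orP => [|]; [rewrite subr_eq0 => /eqP <-; left|rewrite addr_eq0 => /eqP xy; right].
  exists (x / cos (pi / 4)) => //; apply/eqP; rewrite eq_complex /= cE.
  by apply/andP; split; apply/eqP; field.
exists (y / cos (pi / 4)) => //; apply/eqP; rewrite eq_complex /= e3.
rewrite cosDpihalf sinDpihalf cE xy.
by apply/andP; split; apply/eqP; field.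
Qed.

End Expi.

(** * Conjugation of the flag matrix by Fourier and Gauss matrices *)

Section Fourier.
Variables (R : realType) (N : nat).
Hypothesis N_gt0 : (0 < N)%N.

Definition half_root : R[i] := expi (pi / N%:R).
Let h := half_root.
Let w := h ^+ 2.

Let N_neq0 : N%:R != 0 :> R. Proof. by rewrite pnatr_eq0 -lt0n. Qed.
Let h_neq0 : h != 0. Proof. exact: expi_neq0. Qed.

Lemma half_rootXN : h ^+ N = -1.
Proof. by rewrite /h expiX mulrCA divff // mulr1 expi_pi. Qed.

Lemma half_root_sqr_prim : N.-primitive_root w.
Proof.
have hx2 k : h ^+ (N * k.*2) = 1.
  by rewrite exprM half_rootXN -muln2 mulnC exprM sqrrN !expr1n.
rewrite /primitive_root_of_unity N_gt0; apply/forallP => i; apply/eqP.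
apply/unity_rootP/eqP => [|->]; last by rewrite -exprM mulnC (hx2 1%N).
move=> hi; apply/eqP; rewrite eqn_leq ltn_ord /= leqNgt; apply/negP => iN.
have : (h ^+ i.+1) ^+ 2 == 1 by rewrite exprAC hi.
have sin0 : 0 < sin (i.+1%:R * (pi / N%:R) : R).
  apply: sin_gt0_pi; rewrite mulr_gt0 ?divr_gt0 ?pi_gt0 ?ltr0n //=.
  rewrite mulrCA -[ltRHS]mulr1 ltr_pM2l ?pi_gt0 //.
  by rewrite ltr_pdivrMr ?ltr0n // mul1r ltr_nat.
by rewrite expiX sqrf_eq1 !eq_complex /= oppr0 (gt_eqF sin0) !andbF.
Qed.
Let w_prim := half_root_sqr_prim.

Lemma half_root_sqrX k : w ^+ k = expi (2 * pi * k%:R / N%:R).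
Proof. by rewrite -exprM expiX natrM; congr expi; field. Qed.

Lemma invmx_shift_mx : invmx (shift_mx R N) = (shift_mx R N)^T.
Proof.
have e : (shift_mx R N)^T *m shift_mx R N = 1%:M.
  apply/matrixP => i j; rewrite !mxE (bigD1 (ordS i)) //= !mxE eqxx mul1r.
  rewrite (inj_eq (@ordS_inj N)) big1 ?addr0 // => k ki.
  by rewrite !mxE (negPf ki) mul0r.
have [_ u] := mulmx1_unit e.
by rewrite -[LHS]mul1mx -e mulmxK.
Qed.

Lemma scottish_flagE i j : scottish_flag R N i j =
  (i == ordS j)%:R - (j == ordS i)%:R - (i == j)%:R * 'i * (w ^+ i - (w ^+ i)^-1).
Proof.
rewrite /scottish_flag invmx_shift_mx !mxE half_root_sqrX expi_subV.
case: (eqVneq i j) => [<-|_] /=; last by rewrite !mulr0n mulr0 !mul0r subr0 addr0.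
rewrite mulr1n mul1r; congr (_ + _).
by rewrite [RHS](_ : _ = - 'i ^+ 2 * (2 * (sin (2 * pi * i%:R / N%:R))%:C));
  [rewrite sqr_i; ring|ring].
Qed.

Lemma sum_ordS_l (f : 'I_N -> R[i]) j : \sum_l (j == ordS l)%:R * f l = f (ord_pred j).
Proof.
rewrite (bigD1 (ord_pred j)) //= ord_predK eqxx mul1r big1 ?addr0 // => l lj.
by case: eqP => [e|]; rewrite ?mul0r //; rewrite e ordSK eqxx in lj.
Qed.

Lemma sum_ordS_r (f : 'I_N -> R[i]) j : \sum_l (l == ordS j)%:R * f l = f (ordS j).
Proof.
rewrite (bigD1 (ordS j)) //= eqxx mul1r big1 ?addr0 // => l lj.
by rewrite (negPf lj) mul0r.
Qed.

Lemma sum_diag (f : 'I_N -> R[i]) j : \sum_l (j == l)%:R * f l = f j.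
Proof.
rewrite (bigD1 j) //= eqxx mul1r big1 ?addr0 // => l lj.
by rewrite eq_sym (negPf lj) mul0r.
Qed.

Lemma mul_flag_mx (A : 'M[R[i]]_N) j k : (scottish_flag R N *m A) j k =
  A (ord_pred j) k - A (ordS j) k - 'i * (w ^+ j - (w ^+ j)^-1) * A j k.
Proof.
rewrite mxE; under eq_bigr do rewrite scottish_flagE !mulrDl !mulNr.
rewrite !big_split /= !sumrN sum_ordS_l sum_ordS_r; congr (_ - _).
by under eq_bigr do rewrite -!mulrA; rewrite sum_diag; ring.
Qed.

Lemma mulmx_cycle (A : 'M[R[i]]_N) a b j k : (A *m cycle_mx N a b) j (ordS k) =
  A j (ordS (ordS k)) * a (ordS k) + A j k * b k.
Proof.
rewrite mxE; under eq_bigr do rewrite mxE mulrDr mulrCA [A j _ * (_ * _)]mulrCA.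
by rewrite big_split /= sum_ordS_r sum_ordS_l ordSK.
Qed.

Lemma mulmx_flag (A : 'M[R[i]]_N) j k : (A *m scottish_flag R N) j k =
  A j (ordS k) - A j (ord_pred k) - 'i * (w ^+ k - (w ^+ k)^-1) * A j k.
Proof.
rewrite mxE; under eq_bigr do
  rewrite scottish_flagE mulrC [_ == k]eq_sym !mulrDl !mulNr.
rewrite !big_split /= !sumrN sum_ordS_l sum_ordS_r; congr (_ - _).
by under eq_bigr do rewrite -!mulrA; rewrite sum_diag; ring.
Qed.

(** The entries are w^(jk); the Vandermonde form gives invertibility from the distinctness of the
    powers of w. *)
Definition fourier_mx : 'M[R[i]]_N := Vandermonde N (\row_j w ^+ j).

Lemma fourier_mxE j k : fourier_mx j k = (w ^+ k) ^+ j.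
Proof. by rewrite !mxE. Qed.

Lemma det_fourier_mx_neq0 : \det fourier_mx != 0.
Proof.
rewrite det_Vandermonde; apply/prodf_neq0 => i _; apply/prodf_neq0 => j ij.
rewrite !mxE subr_eq0 (eq_prim_root_expr w_prim) !modn_small //.
by rewrite gtn_eqF.
Qed.

Lemma fourier_mx_Sr j k : fourier_mx j (ordS k) = w ^+ j * fourier_mx j k.
Proof. by rewrite !mxE (prim_exprS w_prim) exprMn. Qed.

Lemma expr_ordS k (j : 'I_N) : (w ^+ k) ^+ ordS j = w ^+ k * (w ^+ k) ^+ j.
Proof.
by rewrite exprAC (prim_exprS w_prim) exprMn; congr (_ * _); rewrite exprAC.
Qed.

Lemma fourier_mx_Sl j k : fourier_mx (ordS j) k = w ^+ k * fourier_mx j k.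
Proof. by rewrite !fourier_mxE expr_ordS. Qed.

(** The Fourier matrix turns shifts into multiplications by powers of w and conversely, which swaps
    the two halves of B_N. *)
Lemma flag_mul_fourier :
  scottish_flag R N *m fourier_mx = - 'i *: (fourier_mx *m scottish_flag R N).
Proof.
have w_neq0 k : w ^+ k != 0 by rewrite !expf_neq0.
apply/matrixP => j k; rewrite mul_flag_mx [RHS]mxE mulmx_flag.
have -> : fourier_mx (ord_pred j) k = (w ^+ k)^-1 * fourier_mx j k.
  by rewrite -{2}[j](ord_predK j) fourier_mx_Sl mulKf //.
have -> : fourier_mx j (ord_pred k) = (w ^+ j)^-1 * fourier_mx j k.
  by rewrite -{2}[k](ord_predK k) fourier_mx_Sr mulKf //.
rewrite fourier_mx_Sl fourier_mx_Sr.
set V := fourier_mx j k; set x := w ^+ j; set y := w ^+ k.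
rewrite [RHS](_ : _ = - 'i * (x - x^-1) * V + 'i ^+ 2 * (y - y^-1) * V); last by ring.
by rewrite sqrCi; ring.
Qed.

(** By [flag_mul_fourier], det B_N = (-i)^N det B_N, and (-i)^N = 1 forces 4 | N. *)
Lemma det_flag_eq0 : ~~ (4 %| N)%N -> \det (scottish_flag R N) = 0.
Proof.
move=> N4; have := congr1 determinant flag_mul_fourier.
rewrite detZ !det_mulmx [\det fourier_mx * _]mulrC mulrA.
move=> /(mulIf det_fourier_mx_neq0) /eqP; rewrite -subr_eq0 -{1}[\det _]mul1r -mulrBl.
rewrite mulf_eq0 subr_eq0 => /orP[/eqP iN|/eqP //].
have m1 k : (-1) ^+ k = 1 :> R[i] -> ~~ odd k.
  by rewrite -signr_odd; case: (odd k) => //= /eqP; rewrite expr1 eqNr oner_eq0.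
have iN2 : (-1) ^+ N = 1 :> R[i] by rewrite -sqrCi -sqrrN exprAC -iN expr1n.
have N_even := m1 _ iN2; rewrite -(even_halfK N_even) in iN N4.
move: iN; rewrite -mul2n exprM sqrrN sqrCi => /esym /m1 h_even.
by case/negP: N4; rewrite -(even_halfK h_even) -!muln2 -mulnA dvdn_mull.
Qed.

(** Since h^N = -1, the sign (-1)^j makes the Gaussian h^(j^2) periodic mod N. *)
Definition gauss_mx : 'M[R[i]]_N :=
  \matrix_(j, k) ((-1) ^+ j * h ^+ (j * j) * (w ^+ k) ^+ j).

Lemma det_gauss_mx_neq0 : \det gauss_mx != 0.
Proof.
have -> : gauss_mx = diag_mx (\row_j ((-1) ^+ j * h ^+ (j * j))) *m fourier_mx.
  by apply/matrixP => j k; rewrite mul_diag_mx !mxE.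
rewrite det_mulmx mulf_neq0 ?det_fourier_mx_neq0 // det_diag.
apply/prodf_neq0 => j _; rewrite mxE mulf_neq0 ?signr_eq0 //.
by rewrite expf_neq0.
Qed.

Lemma gauss_mx_Sr j k : gauss_mx j (ordS k) = w ^+ j * gauss_mx j k.
Proof. by rewrite !mxE (prim_exprS w_prim) exprMn; ring. Qed.

Lemma gauss_mx_Sl j k : gauss_mx (ordS j) k = - (h * w ^+ k) * gauss_mx j (ordS k).
Proof.
rewrite gauss_mx_Sr !mxE expr_ordS.
suff -> : (-1) ^+ ordS j * h ^+ (ordS j * ordS j) =
    - h * w ^+ j * ((-1) ^+ j * h ^+ (j * j)) by ring.
have -> : - h * w ^+ j * ((-1) ^+ j * h ^+ (j * j)) = (-1) ^+ j.+1 * h ^+ (j.+1 * j.+1).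
  have -> : (j.+1 * j.+1 = 1 + 2 * j + j * j)%N by lia.
  by rewrite /w -exprM exprS !exprD; ring.
rewrite /=; have [jN|jN] := ltnP j.+1 N; first by rewrite modn_small.
have -> : j.+1 = N by have := ltn_ord j; lia.
by rewrite modnn mul0n !expr0 mulr1 exprM half_rootXN -exprMn mulrNN mulr1 expr1n.
Qed.

(** Both a step in j and a multiplication by w^j or its inverse move column k to a neighbouring
    column, so no diagonal term is left. *)
Lemma flag_mul_gauss :
  scottish_flag R N *m gauss_mx = gauss_mx *m flag_cycle N w 'i h.
Proof.
apply/matrixP => j k; rewrite mul_flag_mx.
have hw k' : h * w ^+ k' != 0 by rewrite mulf_neq0 ?expf_neq0.
rewrite -[k](ord_predK k) mulmx_cycle; move: (ord_pred k) => {}k.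
have hl : gauss_mx (ord_pred j) (ordS k) = - (h * w ^+ k)^-1 * gauss_mx j k.
  by rewrite -{2}[j](ord_predK j) gauss_mx_Sl mulrA mulrNN mulVf ?mul1r //.
rewrite hl gauss_mx_Sl !gauss_mx_Sr.
have [wj wk] : w ^+ j != 0 /\ w ^+ k != 0 by rewrite !expf_neq0.
by field; rewrite wj h_neq0 wk.
Qed.

Lemma det_flag d : \det (d%:M - scottish_flag R N) = \det (d%:M - flag_cycle N w 'i h).
Proof.
apply: (mulIf det_gauss_mx_neq0); rewrite -det_mulmx mulmxBl flag_mul_gauss.
by rewrite -scalar_mxC -mulmxBr det_mulmx mulrC.
Qed.

End Fourier.

(** * Indefinite forms on the cycle and on the path *)

Section Cases.
Variable R : realType.

Lemma odd_subn_eq (j k : nat) : odd j = odd k -> (k <= j)%N -> ~~ odd (j - k).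
Proof. by move=> e kj; rewrite oddB // e addbb. Qed.

(* The weights are the products of [cos t_k / (1 + sin t_k)] with
   [t_k = (2k + 1) pi / N]; they change sign at each step between [m] and [3m],
   where [cos t_k < 0], so all weights at indices of the parity of [m] are positive. *)
Lemma flag_cycle_real m N d : (0 < N)%N -> N = (4 * m)%N ->
  \det (d%:M - flag_cycle N (half_root R N ^+ 2) 'i (half_root R N)) = 0 ->
  'i * d ^+ 2 \is Num.real.
Proof.
move=> N_gt0 NE.
have NR_gt0 : 0 < N%:R :> R by rewrite ltr0n.
have NR_neq0 : N%:R != 0 :> R by rewrite gt_eqF.
have pi_gt0 := pi_gt0 R.
pose t k : R := k.*2.+1%:R * (pi / N%:R).
(* This is the ratio g(k + 1) / g(k) that the edge relation forces for the weights x - i and i - 1/x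
   at x = exp(i t_k). *)
pose f k : R := cos (t k) / (1 + sin (t k)).
pose g k : R := \prod_(l < k) f l.
have t_lt k p : (k.*2.+1 * 2 < p * N)%N -> t k < p%:R * (pi / 2).
  move=> hk; rewrite /t [ltLHS](_ : _ = (k.*2.+1 * 2)%:R / N%:R * (pi / 2)).
    by rewrite ltr_pM2r ?divr_gt0 // ltr_pdivrMr // -natrM ltr_nat.
  by rewrite natrM; field.
have t_gt k p : (p * N < k.*2.+1 * 2)%N -> p%:R * (pi / 2) < t k.
  move=> hk; rewrite /t [ltRHS](_ : _ = (k.*2.+1 * 2)%:R / N%:R * (pi / 2)).
    by rewrite ltr_pM2r ?divr_gt0 // ltr_pdivlMr // -natrM ltr_nat.
  by rewrite natrM; field.
have cos_sign k : (k < N)%N -> 0 < (-1) ^+ (m <= k < 3 * m)%N * cos (t k).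
  move=> kN; case: (ltnP k m) => km /=.
    rewrite mul1r cos_gt0_pihalf //; apply/andP; split.
      have := @t_gt k 0%N; rewrite mul0n mul0r => /(_ isT); lra.
    by have := @t_lt k 1%N; rewrite mul1r; apply; lia.
  case: ltnP => km' /=.
    rewrite expr1 mulN1r -[t k](subrK pi) cosDpi opprK cos_gt0_pihalf //.
    have h1 : 1%:R * (pi / 2) < t k by apply: t_gt; lia.
    have h2 : t k < 3%:R * (pi / 2) by apply: t_lt; lia.
    by apply/andP; split; lra.
  rewrite mul1r -[t k](subrK pi) cosDpi -[t k - pi](subrK pi) cosDpi opprK.
  have h1 : 3%:R * (pi / 2) < t k by apply: t_gt; lia.
  have h2 : t k < 4%:R * (pi / 2) by apply: t_lt; lia.
  by apply: cos_gt0_pihalf; apply/andP; split; lra.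
have cos_neq0 k : (k < N)%N -> cos (t k) != 0.
  by move=> /cos_sign; apply: contraTneq => ->; rewrite mulr0 ltxx.
have sin2 k : sin (t k) * sin (t k) = 1 - cos (t k) * cos (t k).
  by rewrite -!expr2 -(cos2Dsin2 (t k)); ring.
have sin_gt k : (k < N)%N -> 0 < 1 + sin (t k).
  move=> /cos_neq0 ck; have : 0 < cos (t k) * cos (t k)
    by rewrite -expr2 exprn_even_gt0.
  have := sin2 k; have := sin_geN1 (t k); rewrite le_eqVlt => /orP[/eqP <-|]; nra.
have gS k : g k.+1 = g k * f k by rewrite /g big_ord_recr.
(* The exponent counts the indices l < k with m <= l < 3m, where f is negative. *)
have g_sign k : (k <= N)%N -> 0 < (-1) ^+ (minn k (3 * m) - m)%N * g k.
  elim: k => [|k IHk] kN; first by rewrite min0n sub0n mul1r /g big_ord0.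
  rewrite gS; have -> : (minn k.+1 (3 * m) - m =
    (minn k (3 * m) - m) + (m <= k < 3 * m))%N.
    by case: (ltnP k m); case: (ltnP k (3 * m)); rewrite /=; lia.
  rewrite exprD mulrACA mulr_gt0 ?IHk //; first by lia.
  by rewrite /f mulrA mulr_gt0 ?cos_sign ?invr_gt0 ?sin_gt.
(* The reflection replaces t_k by 2 pi - t_k, so the product is cos^2 / (1 - sin^2). *)
have f_rev k : (k < N)%N -> f k * f (N - k.+1)%N = 1.
  move=> kN; have e : t (N - k.+1)%N = - t k + pi *+ 2.
    have -> : t (N - k.+1)%N = ((N - k.+1).*2.+1 + k.*2.+1)%:R * (pi / N%:R) - t k.
      by rewrite /t natrD; ring.
    have -> : ((N - k.+1).*2.+1 + k.*2.+1 = 2 * N)%N by lia.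
    by rewrite natrM; field.
  have hc := cos_neq0 _ kN; have hs := sin_gt _ kN.
  rewrite /f e cosD2pi sinD2pi cosN sinN.
  have hs' : 1 - sin (t k) != 0.
    apply: contra_neq hc => hs'; have := sin2 k; nra.
  rewrite mulf_div (_ : (1 + _) * _ = cos (t k) * cos (t k)) ?divff ?mulf_neq0 //.
  by rewrite -[RHS](subKr 1) -sin2; ring.
(* The form must close up around the cycle: reflection gives (g N)^2 = 1, and the 2m sign changes
   give g N > 0. *)
have gN : g N = 1.
  have g_gt0 : 0 < g N.
    have := g_sign N (leqnn N); have -> : (minn N (3 * m) - m = 2 * m)%N by lia.
    by rewrite exprM sqrrN !expr1n mul1r.
  apply/eqP; rewrite -(@pexpr_eq1 _ _ 2) ?ltW // expr2 {2}/g.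
  rewrite (reindex_inj rev_ord_inj) /= /g -big_split /= big1 // => k _.
  exact: f_rev.
rewrite /flag_cycle /cycle_mx.
apply: (@edge_mx_eigenvalue_real _ _ _ _ _ (fun k => (g k)%:C)
  (fun k : 'I_N => odd k == odd m)).
- by move=> i; rewrite complex_real.
- move=> i /eqP om; rewrite ltcR; have := g_sign i (ltnW (ltn_ord i)).
  rewrite -signr_odd; have -> : odd (minn i (3 * m) - m) = false.
    rewrite /minn; have [_|_] := ltnP i (3 * m).
      have [im|mi] := leqP m i; first by apply/negbTE/odd_subn_eq.
      by have -> : (i - m = 0)%N by lia.
    have -> : (3 * m - m = m.*2)%N by lia.
    exact: odd_double.
  by rewrite expr0 mul1r.
- move=> i j /eqP ->; have [jN|jN] := ltnP j.+1 N.
    by rewrite /= modn_small //=; case: (odd j) (odd m) => [] [].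
  have jN' : j.+1 = N by have := ltn_ord j; lia.
  have oj : odd j.
    have : ~~ odd N by rewrite NE oddM.
    by move/(congr1 odd): jN' => /= <-; rewrite negbK.
  have -> : ordS j = 0%N :> nat by rewrite /= jN' modnn.
  by rewrite oj; case: (odd m).
move=> i j /eqP ->.
have -> : g (ordS j) = g j * f j.
  rewrite -gS /=; have [jN|jN] := ltnP j.+1 N; first by rewrite modn_small.
  have -> : j.+1 = N by have := ltn_ord j; lia.
  by rewrite modnn gN /g big_ord0.
have -> : half_root R N * (half_root R N ^+ 2) ^+ j = expi (t j).
  by rewrite -exprM -exprS mul2n expiX.
have := sin_gt _ (ltn_ord j); have := sin2 j; rewrite -expiN /f.
move: (g j) => gj; rewrite /expi cosN sinN; move: (cos _) (sin _) => c s cs s_gt.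
have s_neq0 : 1 + s != 0 by rewrite gt_eqF.
apply/eqP; rewrite eq_complex /=; apply/andP; split; apply/eqP.
  have cE : c * c = (1 - s) * (1 + s) by rewrite -[c * c](subKr 1) -cs; ring.
  rewrite [LHS](_ : _ = - (c * c) * gj / (1 + s)); last by field.
  by rewrite cE; field.
by field.
Qed.

(** On a path the weights can be rebalanced to t and i t up to sign, with t^2 = |s|. The form is
    then +1 or -1, alternating up to [m] and constant from there on, hence positive on the parity
    class of [m]. *)
Lemma path_mx_real N m d (s : nat -> R) :
    (forall k, (k.+1 < N)%N -> 0 <= (-1) ^+ (k < m)%N * s k) ->
  \det (d%:M - path_mx N (fun k => 1) (fun k => 'i * (s k)%:C)) = 0 ->
  'i * d ^+ 2 \is Num.real.
Proof.
move=> s_ge0; pose t k : R := Num.sqrt `|s k|.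
rewrite (@det_path_mx_prod _ N d _ _ (fun k => (t k)%:C)
  (fun k => 'i * ((-1) ^+ (k < m)%N * t k)%:C)); last first.
  move=> k kN; rewrite mul1r mulrCA -rmorphM /=; congr (_ * _%:C).
  have -> : s k = (-1) ^+ (k < m)%N * ((-1) ^+ (k < m)%N * s k).
    by rewrite mulrA -expr2 sqrr_sign mul1r.
  rewrite [RHS]mulrCA -expr2 sqr_sqrtr ?normr_ge0 //; congr (_ * _).
  by rewrite -[LHS]ger0_norm ?s_ge0 // normrM normr_sign mul1r.
rewrite /path_mx.
apply: (@edge_mx_eigenvalue_real _ _ _ _ _
  (fun k => ((-1) ^+ (m + minn k m) : R)%:C) (fun k : 'I_N => odd k == odd m)).
- by move=> i; rewrite complex_real.
- move=> i /eqP om; rewrite ltcR -signr_odd oddD.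
  have [im|mi] := leqP i m; first by rewrite om addbb expr0 ltr01.
  by rewrite addbb expr0 ltr01.
- by move=> i j /eqP ->; rewrite /=; case: (odd j) (odd m) => [] [].
have conjR (x : R) : (x%:C : R[i])^* = x%:C by apply: conj_Creal; rewrite complex_real.
move=> i j /eqP ->; rewrite -!mulrA -!rmorphM /= conjR; congr (_ * _%:C).
case: (ltnP j m) => jm /=.
  have -> : minn j.+1 m = j.+1 by lia.
  by rewrite addnS [_ ^+ (m + j).+1]exprS expr1; move: (_ ^+ (m + j)) => x; ring.
have -> : minn j.+1 m = m by lia.
by rewrite expr0 mul1r mulrC.
Qed.

(** Vertices are added in pairs. Odd paths start from the zero matrix of size 1; for N = 2 mod 4 the
    start is the path on N/2 + 1 vertices, whose last edge product is the vanishing one. *)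
Lemma det_path_mx0_eq0 N (a b : nat -> R[i]) : (2 < N)%N -> ~~ (4 %| N)%N ->
    (~~ odd N -> a N./2.-1 * b N./2.-1 = 0) ->
  \det (- path_mx N a b) = 0.
Proof.
move=> N_gt2 N4 hab; have [N_odd|N_even] := boolP (odd N).
  have -> : N = (1 + (N./2).*2)%N by rewrite -{1}(odd_double_half N) N_odd.
  by apply: det_path_mx0_add2; rewrite det_mx11 !mxE /= !mul0r addr0 oppr0.
have {}hab := hab N_even; have NE := even_halfK N_even.
have m_odd : odd N./2.
  apply: contraR N4 => m_even.
  by rewrite -NE -(even_halfK m_even) -!muln2 -mulnA dvdn_mull.
move: hab NE m_odd N_gt2; move: (N./2) => [//|m] hab <- /= m_even m_gt0.
have -> : (m.+1.*2 = m.+2 + (m./2).*2)%N by rewrite even_halfK // -addnn; lia.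
apply: det_path_mx0_add2.
rewrite -[- _]add0r -(raddf0 (@scalar_mx _ _)) det_path_mx_rec mul0r hab.
by rewrite mul0r subrr.
Qed.

End Cases.

(** * Assembly of the cases 4 | N and 4 not dividing N *)

Local Open Scope classical_set_scope.

Theorem corollary1p4 (R : realType) (N : nat) (hN : (3 <= N)%N) :
  spec (scottish_flag R N) `<=` X_pi4 R.
Proof.
have N_gt0 : (0 < N)%N by lia.
have NR_neq0 : N%:R != 0 :> R by rewrite pnatr_eq0 -lt0n.
move=> d /eigenvalueP[v hv v_neq0]; apply: i_real_X_pi4.
have {v hv v_neq0} hd : \det (d%:M - scottish_flag R N) = 0.
  apply/eqP/det0P; exists v => //.
  by rewrite mulmxBr hv mul_mx_scalar subrr.
have [/dvdnP[m mN]|N4] := boolP (4 %| N)%N.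
  by apply: (@flag_cycle_real _ m N d N_gt0); rewrite -?det_flag // mulnC.
set h := half_root R N; set w := h ^+ 2.
have h_neq0 : h != 0 by exact: expi_neq0.
have w_prim := half_root_sqr_prim R N_gt0.
have w_neq0 : w != 0 by rewrite expf_neq0.
have i_neq0 : 'i != 0 :> R[i] := neq0Ci _.
have detN (A : 'M[R[i]]_N) : \det (- A) = \det (0%:M - A) by rewrite raddf0 sub0r.
have q0 : \det (- flag_cycle N w 'i h) = 0.
  by rewrite detN -det_flag // -detN -scaleN1r detZ det_flag_eq0 // mulr0.
(* At z = h both determinants vanish, by [hd] and [q0], so the transfer to z = i w applies. *)
have q_cut : \det (d%:M - flag_cycle N w 'i ('i * w)) =
              \det (- flag_cycle N w 'i ('i * w)).
  apply: (@det_flag_cycle_transfer _ N w 'i w_prim h ('i * w) d h_neq0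
    (mulf_neq0 i_neq0 w_neq0)).
  by apply: etrans (esym q0); apply: etrans (esym (det_flag N_gt0 d)) hd.
set a := fun k => 'i * w * w ^+ k - 'i; set b := fun k => 'i - ('i * w * w ^+ k)^-1.
(* The right-hand side is split into the weights 1 and i s_k expected by [path_mx_real]. *)
have abE k : a k * b k = 1 * ('i * (- 2 * sin (2 * pi * k.+1%:R / N%:R))%:C).
  rewrite /a /b -mulrA -exprS.
  have -> : ('i * w ^+ k.+1)^-1 = - 'i * (w ^+ k.+1)^-1 by rewrite invfM invCi.
  have wk : w ^+ k.+1 != 0 by rewrite expf_neq0.
  rewrite rmorphM rmorphN rmorph_nat /=.
  rewrite [LHS](_ : _ = 'i ^+ 2 * (w ^+ k.+1 - (w ^+ k.+1)^-1)); last by field.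
  by rewrite sqrCi half_root_sqrX // expi_subV; ring.
(* The choice z = i w is made for this: i w^N - i = 0. *)
have a_last : a N.-1 = 0.
  by rewrite /a -mulrA -exprS prednK // prim_expr_order // mulr1 subrr.
have cutE e : \det (e%:M - flag_cycle N w 'i ('i * w)) =
    \det (e%:M - path_mx N a b) - b N.-1 * ((-1) ^+ N.-1 * \prod_(i < N.-1) - b i).
  exact: det_cycle_mx_cut.
(* For even N the middle edge, at k = N/2 - 1, has product -2 i sin(pi) = 0. *)
have p0 : \det (- path_mx N a b) = 0.
  apply: det_path_mx0_eq0 => // N_even; rewrite abE prednK; last by lia.
  have -> : 2 * pi * (N./2)%:R / N%:R = pi :> R.
    rewrite -[in X in _ / X](even_halfK N_even) -muln2 natrM.
    by field; rewrite pnatr_eq0; lia.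
  by rewrite sinpi !mulr0.
(* The cut term is the same at [d] and at 0, so it cancels. *)
have p_d : \det (d%:M - path_mx N a b) = 0.
  apply: (subIr (b N.-1 * ((-1) ^+ N.-1 * \prod_(i < N.-1) - b i))).
  apply: etrans (esym (cutE d)) _; apply: etrans q_cut _.
  by apply: etrans (detN _) _; apply: etrans (cutE 0) _; rewrite -detN p0.
have {p_d} := etrans (esym (det_path_mx_prod d (fun k _ => abE k))) p_d.
(* The angle 2 pi (k + 1) / N is at most pi for k < [N./2] and lies in [pi, 2 pi] afterwards, so the
   edge products change sign at [N./2]. *)
apply: (@path_mx_real _ N N./2) => k kN; have pi_ge0 := pi_ge0 R.
set t := 2 * pi * _ / _; have tE : t = k.+1.*2%:R / N%:R * pi.
  by rewrite /t -muln2 natrM; field.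
have [km|mk] := ltnP k N./2.
  rewrite expr1 mulN1r mulNr opprK mulr_ge0 // sin_ge0_pi // tE.
  rewrite mulr_ge0 ?divr_ge0 //= ler_piMl // ler_pdivrMr ?ltr0n // mul1r ler_nat.
  by lia.
rewrite expr0 mul1r mulNr -mulrN mulr_ge0 // -[t](subrK pi) sinDpi opprK.
have t_ge : pi <= t.
  by rewrite tE ler_peMl // ler_pdivlMr ?ltr0n // mul1r ler_nat; lia.
have t_le : t <= 2 * pi.
  by rewrite tE ler_wpM2r // ler_pdivrMr ?ltr0n // -natrM ler_nat; lia.
by apply: sin_ge0_pi; apply/andP; split; lra.
Qed.
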